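(* Let $a\ge 1$ and $b\ge 1$ be integers. Then $\gcd(R_a,R_b)=R_{\gcd(a,b)}$.
   Context: For an integer $n\ge 1$, the repunit $R_n$ is the natural number whose decimal expansion consists of exactly $n$ digits $1$, i.e. $R_n=(10^n-1)/9$. *)

(* Defs.v *)
From mathcomp Require Import all_boot.
Set Implicit Arguments. Unset Strict Implicit. Unset Printing Implicit Defensive.

Definition repunit (n : nat) : nat := (10 ^ n - 1) %/ 9.

(* The truncated division and subtraction above are exact, and the value is
   the number whose decimal expansion is n digits 1. *)
Lemma repunit_digits (n : nat) : repunit n = \sum_(i < n) 1 * 10 ^ i.
Proof.
rewrite /repunit subn1 predn_exp mulKn //.
by apply: eq_bigr => i _; rewrite mul1n.
Qed.

(* Main.v *)
Require Import Defs.
From mathcomp Require Import all_boot.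

(** Writing [n + m] ones as a block of [n] ones followed by [m] ones shows that
    [repunit (n + m)] is a multiple of [repunit n] plus [repunit m]; hence
    replacing the index [n + m] by [m] leaves the gcd with [repunit n]
    unchanged. The subtractive Euclidean algorithm on the indices is therefore
    mirrored by the repunits ([gcdn_repunitDl]), and both computations end
    together because [repunit 0 = 0]. *)

Lemma repunit0 : repunit 0 = 0.
Proof. by []. Qed.

(** The weight [10 ^ m] shifts the leading block of [n] digits past the
    [m] trailing ones. *)
Lemma repunitD n m : repunit (n + m) = 10 ^ m * repunit n + repunit m.
Proof.
rewrite !repunit_digits addnC big_split_ord /= addnC big_distrr /=.
by congr (_ + _); apply: eq_bigr => i _; rewrite !mul1n expnD.
Qed.

(** One subtraction step of the Euclidean algorithm on the indices. *)
Lemma gcdn_repunitDl n m :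
  gcdn (repunit n) (repunit (n + m)) = gcdn (repunit n) (repunit m).
Proof. by rewrite repunitD gcdnMDl. Qed.

(** Allowing zero indices gives the Euclidean recursion its base case. *)
Lemma gcdn_repunit a b : gcdn (repunit a) (repunit b) = repunit (gcdn a b).
Proof.
have [s] := ubnP (a + b); elim: s a b => // s IHs a b lt_ab_s.
wlog le_ab: a b lt_ab_s / a <= b => [IHle|].
  case/orP: (leq_total a b) => [|le_ba]; first exact: IHle.
  by rewrite gcdnC (gcdnC a); apply: IHle; rewrite // addnC.
case: (posnP a) => [->|a_gt0]; first by rewrite repunit0 !gcd0n.
rewrite -(subnKC le_ab) gcdn_repunitDl gcdnDl IHs // subnKC //.
(* The sum of the indices drops from [a + b] to [b], strictly as [0 < a]. *)
by rewrite -ltnS; apply: leq_trans lt_ab_s; rewrite ltnS -[X in X < _]add0n ltn_add2r.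
Qed.

Theorem theorem3 (a b : nat) (ha : 1 <= a) (hb : 1 <= b) :
  gcdn (repunit a) (repunit b) = repunit (gcdn a b).
Proof. exact: gcdn_repunit. Qed.
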